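(* Let $0<p<1$ and let $L(n)$ be the length of the longest success run in the first $n$ of a sequence of i.i.d. Bernoulli($p$) trials. As $n\to\infty$, the moment generating function of $L(n)$ has the following asymptotics. (i) Subcritical regime: for every real $\lambda<\ln(1/p)$, $$\ln \mathbb{E}\exp\{\lambda L(n)\}\sim \lambda\,\log_{1/p} n$$ (for $\lambda=0$ both sides are identically $0$ and the statement is understood as this trivial equality). (ii) Critical regime: for $\lambda=\ln(1/p)$, $$\ln \mathbb{E}\exp\{\lambda L(n)\}\sim 2\lambda\,\log_{1/p} n.$$ (iii) Supercritical regime: for every real $\lambda>\ln(1/p)$, $$\ln \mathbb{E}\exp\{\lambda L(n)\}\sim (\lambda-\ln(1/p))\, n.$$
   Context: $X_1,X_2,\ldots$ are i.i.d. with $\mathbb{P}(X_i=1)=p$, $\mathbb{P}(X_i=0)=q:=1-p$. For $n\ge 1$, $L(n)$ is the largest integer $\ell\ge 0$ such that $X_{i+1}+\cdots+X_{i+\ell}=\ell$ for some $0\le i\le n-\ell$ (so $L(n)=0$ if $X_1=\cdots=X_n=0$). $\ln$ is the natural logarithm and $\log_{1/p}$ is the logarithm with base $1/p$. $a_n\sim b_n$ means $a_n/b_n\to 1$ as $n\to\infty$. *)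

(* Defs.v *)
From HB Require Import structures.
From mathcomp Require Import all_boot all_order all_algebra finmap.
From mathcomp Require Import all_classical all_reals all_analysis.
Set Implicit Arguments.
Unset Strict Implicit.
Unset Printing Implicit Defensive.
Import Order.TTheory GRing.Theory Num.Theory.
Import numFieldNormedType.Exports.
Local Open Scope classical_set_scope.
Local Open Scope ring_scope.

Definition mutually_independent (d d' : measure_display)
    (T : measurableType d) (T' : measurableType d') (R : realType)
    (P : probability T R) (I : choiceType) (X : I -> {RV P >-> T'}) : Prop :=
  forall (J : {fset I}) (A : I -> set T'),
    (forall i, i \in J -> measurable (A i)) ->
    P (\bigcap_(i in [set` J]) (X i @^-1` A i)) =
    (\prod_(i <- J) P (X i @^-1` A i))%E.

(* Trials are numbered from 0: [X j] is the (j+1)-st trial. The two marginal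
   conditions fix the law of each [X j], so they include identical
   distribution. *)
Definition iid_bernoulli (d : measure_display) (T : measurableType d)
    (R : realType) (P : probability T R) (p : R)
    (X : nat -> {RV P >-> R}) : Prop :=
  [/\ mutually_independent X,
      forall j, P [set w | X j w = 1] = p%:E &
      forall j, P [set w | X j w = 0] = (1 - p)%:E].

(* [i + l <= n] is the constraint i <= n - l with untruncated subtraction. *)
Definition has_run (R : realType) (x : nat -> R) (n l : nat) : bool :=
  [exists i : 'I_n.+1, (i + l <= n)%N && (\sum_(i <= j < i + l) x j == l%:R)].

(* A run among the first [n] trials has length at most [n], and length 0 always
   qualifies, so the bounded maximum is the largest admissible length. *)
Definition longest_run (R : realType) (x : nat -> R) (n : nat) : nat :=
  \max_(l < n.+1 | has_run x n l) l.

(* ln E exp(lambda L(n)); [fine] loses nothing since 0 <= L(n) <= n makes the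
   moment generating function finite. *)
Definition log_mgf_run (d : measure_display) (T : measurableType d)
    (R : realType) (P : probability T R) (X : nat -> {RV P >-> R})
    (lambda : R) (n : nat) : R :=
  ln (fine ('M_P (fun w => (longest_run (fun j => X j w) n)%:R) lambda)).

Definition log_base (R : realType) (b x : R) : R := ln x / ln b.

Definition asymp_equiv (R : realType) (a b : nat -> R) : Prop :=
  a n / b n @[n --> \oo] --> (1 : R).

(* Main.v *)
(* The law of the first n trials is the product weight on bit sequences of
   length n; let a(n, l) be the resulting probability of a run of length at least
   l.  Deciding whether deleting the first bit destroys the last such run gives
     a(n+1, l) = a(n, l) + (1-p) p^l (1 - a(n-l, l))      (l >= 1, n >= l),
   and since a is nondecreasing in n this yields
     a(n, l) <= n p^l,
     (n-l) (1-p) p^l (1 - a(n, l)) <= a(n, l),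
     1 - a(n, l) <= (1 - (1-p) p^l)^(n-l).
   Testing exp(lambda L) against indicators of {L >= l} then determines
   ln E exp(lambda L) up to an additive error O(1 + sqrt(main term)): the optimal
   l is about log_(1/p) n in the subcritical regime and n in the supercritical
   one, while at lambda = ln(1/p) all l between n/4 and n/2 contribute terms of
   order n, hence n^2 in total. *)

Require Import Defs.
From HB Require Import structures.
From mathcomp Require Import all_boot all_order all_algebra finmap.
From mathcomp Require Import all_classical all_reals all_analysis.
From mathcomp Require Import measurable_realfun ring lra zify.
Import Order.TTheory GRing.Theory Num.Theory.
Import numFieldNormedType.Exports.
Local Open Scope classical_set_scope.
Local Open Scope ring_scope.

(** * Bit sequences, their product weight and their longest run of successes *)

Fixpoint bitseqs (n : nat) : seq bitseq :=
  if n is m.+1 then map (cons true) (bitseqs m) ++ map (cons false) (bitseqs m)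
  else [:: [::]].

Definition bern_weight {R : realType} (p : R) (s : bitseq) : R :=
  \prod_(b <- s) (if b then p else 1 - p).

Definition bern_mean {R : realType} (p : R) (n : nat) (f : bitseq -> R) : R :=
  \sum_(s <- bitseqs n) bern_weight p s * f s.

(** Shaped like [longest_run], a bounded maximum over admissible lengths, so that the two agree as
    soon as their predicates do. *)
Definition runlen (s : bitseq) : nat :=
  \max_(l < (size s).+1 | infix (nseq l true) s) l.

Lemma mem_bitseqs n s : (s \in bitseqs n) = (size s == n).
Proof.
elim: n s => [|n IHn] s /=; first by rewrite inE; case: s.
rewrite mem_cat; case: s => [|b s]; first by apply/orP => -[] /mapP[].
have inj c : injective (cons c : bitseq -> bitseq) by move=> u v [].
have notin c : b != c -> (b :: s \in map (cons c) (bitseqs n)) = false.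
  by move=> bc; apply/mapP => -[u _ [eb _]]; rewrite eb eqxx in bc.
by case: b notin => notin; rewrite mem_map // IHn eqSS notin // orbF.
Qed.

Lemma uniq_bitseqs n : uniq (bitseqs n).
Proof.
elim: n => //= n IHn.
have inj c : injective (cons c : bitseq -> bitseq) by move=> u v [].
rewrite cat_uniq !map_inj_uniq // IHn /= andbT; apply/hasPn => _ /mapP[u _ ->].
by apply/mapP => -[v _].
Qed.

Lemma infix_nseq_leq l l' s :
  (l <= l')%N -> infix (nseq l' true) s -> infix (nseq l true) s.
Proof. by move=> /subnK <-; rewrite nseqD => /catl_infix. Qed.

(** Admissible lengths are closed downwards, so tail events of [runlen] become infix events, whose
    weights [run_prob] measures. *)
Lemma leq_runlen l s : (l <= runlen s)%N = infix (nseq l true) s.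
Proof.
have run_s : infix (nseq (runlen s) true) s.
  rewrite /runlen; elim/big_ind: _ => [|k m|//]; first exact: infix0s.
  by move=> ks ms; rewrite /maxn; case: ifP.
apply/idP/idP => [/infix_nseq_leq|ls]; first exact.
have ltl : (l < (size s).+1)%N.
  by have := size_infix ls; rewrite size_nseq ltnS.
exact: (@leq_bigmax_cond _ _ (fun i : 'I_(size s).+1 => nat_of_ord i)
  (Ordinal ltl)).
Qed.

Lemma runlen_size s : (runlen s <= size s)%N.
Proof.
have : infix (nseq (runlen s) true) s by rewrite -leq_runlen.
by move=> /size_infix; rewrite size_nseq.
Qed.

(** The leading block is too short to hold the run, and no run crosses the failure that ends it. *)
Lemma infix_nseq_head l k s : (k <= l)%N ->
  infix (nseq l.+1 true) (nseq k true ++ false :: s) = infix (nseq l.+1 true) s.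
Proof.
have noprefix i : (i <= l)%N ->
    prefix (nseq l.+1 true) (nseq i true ++ false :: s) = false.
  by elim: i l => [|i IHi] [|l] //= /IHi.
elim: k => [|k IHk] kl; first by rewrite cat0s infix_consl.
by rewrite infix_consl (noprefix k.+1) // IHk // ltnW.
Qed.

(* A run of length [l.+1] that starts at the first bit and is lost when this
   bit is deleted is followed by a failure or by the end of the sequence. *)
Lemma infix_nseq_behead {R : realType} l b s :
  (infix (nseq l.+1 true) (b :: s))%:R - (infix (nseq l.+1 true) s)%:R =
  (prefix (nseq l.+1 true) (b :: s))%:R *
  (if drop l.+1 (b :: s) is c :: u then
     (~~ c)%:R * (1 - (infix (nseq l.+1 true) u)%:R) else 1) :> R.
Proof.
rewrite infix_consl; have [|_] := boolP (prefix _ _); last first.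
  by rewrite /= subrr mul0r.
case: b => //; rewrite prefix_cons eqxx andTb => /prefixP[u ->].
rewrite mul1r /= drop_size_cat ?size_nseq //.
case: u => [|[] u].
- rewrite cats0 (_ : infix _ _ = false) ?subr0 //.
  by apply/negP => /size_infix; rewrite /= !size_nseq ltnn.
- rewrite mul0r (_ : nseq l true ++ true :: u = nseq l.+1 true ++ u).
    by rewrite -[true :: nseq l true]/(nseq l.+1 true) prefix_infix subrr.
  by elim: l => //= l ->.
- by rewrite infix_nseq_head // mul1r.
Qed.

(** * Means under the product weight *)

Section bern_mean_theory.
Context {R : realType} (p : R).
Hypotheses (p_ge0 : 0 <= p) (p_le1 : p <= 1).

Lemma bern_weight_ge0 s : 0 <= bern_weight p s.
Proof. by apply: prodr_ge0 => -[] _; rewrite ?subr_ge0. Qed.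

Lemma bern_mean0 f : bern_mean p 0 f = f [::].
Proof. by rewrite /bern_mean /= big_seq1 /bern_weight big_nil mul1r. Qed.

Lemma bern_meanS n f : bern_mean p n.+1 f =
  p * bern_mean p n (f \o cons true) + (1 - p) * bern_mean p n (f \o cons false).
Proof.
rewrite /bern_mean /= big_cat !big_map /= !big_distrr /=; congr (_ + _);
  by apply: eq_bigr => s _; rewrite /bern_weight big_cons mulrA.
Qed.

Lemma eq_bern_mean n f g : (forall s, size s = n -> f s = g s) ->
  bern_mean p n f = bern_mean p n g.
Proof.
move=> fg; rewrite /bern_mean !big_seq; apply: eq_bigr => s.
by rewrite mem_bitseqs => /eqP /fg ->.
Qed.

Lemma ler_bern_mean n f g : (forall s, size s = n -> f s <= g s) ->
  bern_mean p n f <= bern_mean p n g.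
Proof.
move=> fg; rewrite /bern_mean !big_seq; apply: ler_sum => s.
by rewrite mem_bitseqs => /eqP /fg; exact/ler_wpM2l/bern_weight_ge0.
Qed.

Lemma bern_meanD n f g :
  bern_mean p n (fun s => f s + g s) = bern_mean p n f + bern_mean p n g.
Proof.
by rewrite /bern_mean -big_split; apply: eq_bigr => s _; rewrite mulrDr.
Qed.

Lemma bern_meanZ n c f :
  bern_mean p n (fun s => c * f s) = c * bern_mean p n f.
Proof. by rewrite /bern_mean big_distrr; apply: eq_bigr => s _; rewrite mulrCA. Qed.

Lemma bern_mean_cst n c : bern_mean p n (fun=> c) = c.
Proof.
elim: n => [|n IHn]; first by rewrite bern_mean0.
by rewrite bern_meanS !IHn -mulrDl addrC subrK mul1r.
Qed.

Lemma bern_meanB n f g :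
  bern_mean p n (fun s => f s - g s) = bern_mean p n f - bern_mean p n g.
Proof.
rewrite -[- bern_mean p n g]mulN1r -bern_meanZ -bern_meanD.
by apply: eq_bern_mean => s _; rewrite mulN1r.
Qed.

Lemma bern_mean_sum n (I : Type) (r : seq I) (P : pred I) (f : I -> bitseq -> R) :
  bern_mean p n (fun s => \sum_(i <- r | P i) f i s) =
  \sum_(i <- r | P i) bern_mean p n (f i).
Proof.
rewrite /bern_mean exchange_big; apply: eq_bigr => s _.
by rewrite big_distrr.
Qed.

Lemma bern_mean_behead n f : bern_mean p n.+1 (f \o behead) = bern_mean p n f.
Proof. by rewrite bern_meanS -mulrDl addrC subrK mul1r. Qed.

(** Independence of the first [l] bits from the remaining [m]: only the all-success prefix survives,
    with weight [p ^+ l]. *)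
Lemma bern_mean_prefix l m f :
  bern_mean p (l + m) (fun s => (prefix (nseq l true) s)%:R * f (drop l s)) =
  p ^+ l * bern_mean p m f.
Proof.
elim: l => [|l IHl].
  rewrite mul1r; apply: eq_bern_mean => s _.
  by rewrite prefix0s mul1r drop0.
rewrite addSn bern_meanS exprS -mulrA -IHl.
rewrite [X in _ + (1 - p) * X](_ : _ = 0) ?mulr0 ?addr0 //.
by rewrite -[RHS](bern_mean_cst (l + m)); apply: eq_bern_mean => s _; rewrite /= mul0r.
Qed.

(** * Probability of a run of given length: recursion and bounds *)

Definition run_prob (n l : nat) : R :=
  bern_mean p n (fun s => (infix (nseq l true) s)%:R).

Lemma run_prob_ge0 n l : 0 <= run_prob n l.
Proof. by rewrite -(bern_mean_cst n 0); apply: ler_bern_mean => s _. Qed.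

Lemma run_prob_le1 n l : run_prob n l <= 1.
Proof.
by rewrite -(bern_mean_cst n 1); apply: ler_bern_mean => s _; rewrite lern1 leq_b1.
Qed.

Lemma run_prob_small n l : (n < l)%N -> run_prob n l = 0.
Proof.
move=> nl; rewrite -[RHS](bern_mean_cst n 0); apply: eq_bern_mean => s sn.
rewrite (_ : infix _ _ = false) //.
by apply/negP => /size_infix; rewrite size_nseq sn leqNgt nl.
Qed.

(** Deleting the first bit cannot create a run, and it does not change the law of the others. *)
Lemma le_run_prob n m l : (n <= m)%N -> run_prob n l <= run_prob m l.
Proof.
move=> /subnK <-; elim: (m - n)%N => // k; move/le_trans; apply.
rewrite addSn /run_prob -bern_mean_behead; apply: ler_bern_mean => -[|b s] // _.
by rewrite [in leRHS]infix_consl ler_nat /=; case: (infix _ s); rewrite ?orbT.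
Qed.

Lemma run_probS_behead l n :
  run_prob n.+1 l.+1 - run_prob n l.+1 =
  bern_mean p n.+1 (fun s => (prefix (nseq l.+1 true) s)%:R *
  (if drop l.+1 s is c :: u then
     (~~ c)%:R * (1 - (infix (nseq l.+1 true) u)%:R) else 1)).
Proof.
rewrite /run_prob -[bern_mean p n _]bern_mean_behead -bern_meanB.
by apply: eq_bern_mean => -[|b s] // _; rewrite /comp -infix_nseq_behead.
Qed.

Lemma run_prob_self l : run_prob l.+1 l.+1 = p ^+ l.+1.
Proof.
have := run_probS_behead l l; rewrite (@run_prob_small l) // subr0 => ->.
rewrite -[X in bern_mean p X]addn0 (bern_mean_prefix _ _ (fun t => if t is c :: u then
     (~~ c)%:R * (1 - (infix (nseq l.+1 true) u)%:R) else 1)).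
by rewrite bern_mean0 mulr1.
Qed.

(** The gain from one more bit comes from sequences that start with [l.+1] successes, then a failure
    (whence [1 - p]), then [m] bits without such a run. *)
Lemma run_prob_rec l m :
  run_prob (l.+1 + m.+1) l.+1 =
  run_prob (l.+1 + m) l.+1 + (1 - p) * p ^+ l.+1 * (1 - run_prob m l.+1).
Proof.
have := run_probS_behead l (l.+1 + m).
rewrite -addnS (bern_mean_prefix _ _ (fun t => if t is c :: u then
     (~~ c)%:R * (1 - (infix (nseq l.+1 true) u)%:R) else 1)) => /eqP.
rewrite subr_eq => /eqP ->; rewrite addrC; congr (_ + _).
rewrite bern_meanS [X in p * X](_ : _ = 0) ?mulr0 ?add0r; last first.
  by rewrite -[RHS](bern_mean_cst m 0); apply: eq_bern_mean => s _; rewrite /= mul0r.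
rewrite mulrA [p ^+ _ * _]mulrC; congr (_ * _).
rewrite -[X in _ = X - _](bern_mean_cst m 1) -bern_meanB.
by apply: eq_bern_mean => s _; rewrite /= mul1r.
Qed.

Lemma run_prob_ub n l : (0 < n)%N -> run_prob n l <= n%:R * p ^+ l.
Proof.
move=> n_gt0; case: l => [|l].
  by rewrite mulr1 (le_trans (run_prob_le1 _ _)) // ler1n.
have pl_ge0 : 0 <= p ^+ l.+1 by rewrite exprn_ge0.
have [nl|/subnKC <-] := ltnP n l.+1; first by rewrite run_prob_small // mulr_ge0.
(* The induction uses the sharper factor, the number of possible starting positions: the first
   contributes [p ^+ l.+1], and each further bit adds at most as much. *)
apply: (@le_trans _ _ ((n - l.+1).+1%:R * p ^+ l.+1)); last first.
  by rewrite ler_wpM2r // ler_nat; lia.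
elim: (n - l.+1)%N => [|m IHm]; first by rewrite addn0 run_prob_self mul1r.
rewrite run_prob_rec -[m.+2%:R]natr1 [in leRHS]mulrDl mul1r lerD // mulrAC.
rewrite -[leRHS]mul1r ler_wpM2r // mulr_ile1 ?subr_ge0 ?run_prob_le1 //.
  by rewrite lerBlDr lerDl.
by rewrite lerBlDr lerDl run_prob_ge0.
Qed.

Lemma run_prob0 n : run_prob n 0 = 1.
Proof. by rewrite -[RHS](bern_mean_cst n 1); apply: eq_bern_mean => s; rewrite infix0s. Qed.

(** By monotonicity in the number of trials, each of the [n - l] recursion steps gains at least
    [(1 - p) * p ^+ l] times the final probability of no run. *)
Lemma run_prob_lb n l : (l <= n)%N ->
  (n - l)%:R * ((1 - p) * p ^+ l) * (1 - run_prob n l) <= run_prob n l.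
Proof.
case: l => [|l] ln; first by rewrite run_prob0 subrr mulr0.
rewrite -{2 3}(subnKC ln); elim: (n - _)%N => [|m IHm].
  by rewrite !mul0r run_prob_ge0.
have c_ge0 : 0 <= (1 - p) * p ^+ l.+1 by rewrite mulr_ge0 ?subr_ge0 ?exprn_ge0.
have mono1 : run_prob (l.+1 + m) l.+1 <= run_prob (l.+1 + m.+1) l.+1.
  by rewrite le_run_prob // leq_add2l.
have mono2 : run_prob m l.+1 <= run_prob (l.+1 + m.+1) l.+1.
  by rewrite le_run_prob //; lia.
set c := (1 - p) * p ^+ l.+1 in c_ge0 IHm *.
rewrite [in leRHS]run_prob_rec -/c -natr1 2!mulrDl mul1r lerD //.
  by apply: le_trans IHm; rewrite ler_wpM2l ?lerD2l ?lerN2 // mulr_ge0.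
by rewrite ler_wpM2l // lerD2l lerN2.
Qed.

(** In the recursion the shorter sequence is at least as likely to have no run, so each extra bit
    multiplies the probability of no run by at most [1 - (1 - p) * p ^+ l]. *)
Lemma no_run_prob_ub n l : (l <= n)%N ->
  1 - run_prob n l <= (1 - (1 - p) * p ^+ l) ^+ (n - l).
Proof.
case: l => [|l] ln.
  by rewrite run_prob0 subrr expr0 mulr1 opprB addrC subrK exprn_ge0.
rewrite -{1}(subnKC ln); elim: (n - _)%N => [|m IHm].
  by rewrite lerBlDr lerDl run_prob_ge0.
have c_ge0 : 0 <= (1 - p) * p ^+ l.+1 by rewrite mulr_ge0 ?subr_ge0 ?exprn_ge0.
have c_le1 : (1 - p) * p ^+ l.+1 <= 1.
  by rewrite mulr_ile1 ?subr_ge0 ?exprn_ge0 ?exprn_ile1 // lerBlDr lerDl.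
have mono : run_prob m l.+1 <= run_prob (l.+1 + m) l.+1.
  by rewrite le_run_prob // leq_addl.
rewrite run_prob_rec [(_ - _) ^+ m.+1]exprS.
set c := (1 - p) * p ^+ l.+1 in c_ge0 c_le1 IHm *.
have dec : (1 - c) * (1 - run_prob (l.+1 + m) l.+1) <= (1 - c) * (1 - c) ^+ m.
  by rewrite ler_wpM2l // subr_ge0.
by apply: le_trans dec; have := ler_wpM2l c_ge0 mono; lra.
Qed.

Lemma run_prob_all n : p ^+ n <= run_prob n n.
Proof. by case: n => [|n]; rewrite ?run_prob0 ?run_prob_self. Qed.

(** * Bounds on the moment generating function by run probabilities *)

Definition run_mgf (lambda : R) (n : nat) : R :=
  bern_mean p n (fun s => expR (lambda * (runlen s)%:R)).

Lemma run_mgf_lb_ge0 lambda n l : 0 <= lambda ->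
  expR (lambda * l%:R) * run_prob n l <= run_mgf lambda n.
Proof.
move=> lambda_ge0; rewrite -bern_meanZ; apply: ler_bern_mean => s _.
rewrite -leq_runlen; case: leqP => ls; last by rewrite mulr0 expR_ge0.
by rewrite mulr1 ler_expR ler_wpM2l // ler_nat.
Qed.

(** Pointwise, the first term dominates when the longest run is at most [k]; otherwise the summand
    at [l = runlen s] does, its indicator being 1. *)
Lemma run_mgf_ub_ge0 lambda n k : 0 <= lambda -> run_mgf lambda n <=
  expR (lambda * k%:R) + \sum_(k.+1 <= l < n.+1) expR (lambda * l%:R) * run_prob n l.
Proof.
move=> lambda_ge0.
under eq_bigr do rewrite -bern_meanZ.
rewrite -bern_mean_sum -[X in X + _](bern_mean_cst n) -bern_meanD.
apply: ler_bern_mean => s sn; have [sk|ks] := leqP (runlen s) k.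
  by rewrite ler_wpDr ?sumr_ge0 // 1?ler_expR ?ler_wpM2l ?ler_nat // => i _;
     rewrite mulr_ge0 ?expR_ge0.
have s_le : (runlen s <= n)%N by rewrite -sn runlen_size.
rewrite ler_wpDl ?expR_ge0 // (bigD1_seq (runlen s)) ?iota_uniq ?mem_index_iota ?ks ?ltnS //=.
rewrite -leq_runlen leqnn mulr1 ler_wpDr // sumr_ge0 // => i _.
Qed.

Lemma run_mgf_lb_le0 lambda n k : lambda <= 0 ->
  expR (lambda * k%:R) * (1 - run_prob n k.+1) <= run_mgf lambda n.
Proof.
move=> lambda_le0; rewrite -[X in X - _](bern_mean_cst n 1) -bern_meanB -bern_meanZ.
apply: ler_bern_mean => s _; rewrite -leq_runlen; case: leqP => ls.
  by rewrite subr0 mulr1 ler_expR ler_wnM2l // ler_nat.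
by rewrite subrr mulr0 expR_ge0.
Qed.

(** For a nonpositive parameter short runs carry the mean; where no run of length [l] occurs, the
    exponential is bounded by 1. *)
Lemma run_mgf_ub_le0 lambda n l : lambda <= 0 ->
  run_mgf lambda n <= expR (lambda * l%:R) + (1 - run_prob n l).
Proof.
move=> lambda_le0; rewrite -[X in X - _](bern_mean_cst n 1) -bern_meanB.
rewrite -[X in X + _](bern_mean_cst n) -bern_meanD.
apply: ler_bern_mean => s _; rewrite -leq_runlen; case: leqP => ls.
  by rewrite subrr addr0 ler_expR ler_wnM2l // ler_nat.
by rewrite subr0 ler_wpDl ?expR_ge0 // -expR0 ler_expR mulr_le0_ge0.
Qed.

(* Abel summation: [p^-L] dominates the telescoping sum of
   [p^-l - p^-(l-1) = (1 - p) p^-l] over [1 <= l <= L]. *)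
Lemma run_mgf_lb_critical n : 0 < p ->
  \sum_(1 <= l < n.+1) (1 - p) * p^-1 ^+ l * run_prob n l <= run_mgf (ln (1 / p)) n.
Proof.
move=> p_gt0; under eq_bigr do rewrite -bern_meanZ.
rewrite -bern_mean_sum; apply: ler_bern_mean => s sn.
have s_le : (runlen s <= n)%N by rewrite -sn runlen_size.
rewrite expRM_natr div1r lnK ?posrE ?invr_gt0 //.
rewrite (big_cat_nat (n := (runlen s).+1)) //=.
rewrite [X in _ + X]big_nat_cond [X in _ + X]big1 ?addr0; last first.
  by move=> l; rewrite andbT -leq_runlen ltnNge => /andP[/negbTE -> _];
    rewrite mulr0.
apply: (@le_trans _ _ (\sum_(1 <= l < (runlen s).+1) (1 - p) * p^-1 ^+ l)).
  apply: ler_sum => l _; rewrite ler_piMr ?lern1 ?leq_b1 //.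
  by rewrite mulr_ge0 ?subr_ge0 ?exprn_ge0 ?invr_ge0.
elim: (runlen s) => [|k IHk]; first by rewrite big_geq // expr0.
rewrite big_nat_recr //= [in leRHS]exprS exprS.
set v := p^-1 ^+ k in IHk *.
have upv : p * (p^-1 * v) = v by rewrite mulrA mulfV ?mul1r // lt0r_neq0.
by rewrite mulrBl mul1r upv addrCA gerDl subr_le0.
Qed.

End bern_mean_theory.

(** * Transfer from the random trials to bit sequences *)

Lemma sum_run_bits {R : realType} (x : nat -> R) (s : bitseq) i l :
  (forall j, (j < size s)%N -> x j = (nth false s j)%:R) -> (i + l <= size s)%N ->
  \sum_(i <= j < i + l) x j = (count id (take l (drop i s)))%:R.
Proof.
move=> xs; elim: l => [|l IHl] il; first by rewrite addn0 big_geq ?take0.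
rewrite addnS big_nat_recr ?leq_addr //= IHl; last by rewrite (leq_trans _ il) ?addnS.
rewrite (take_nth false) ?size_drop; last by rewrite ltn_subRL -addnS.
rewrite -cats1 count_cat natrD /= addn0 nth_drop xs //.
by rewrite -addnS.
Qed.

Lemma has_run_bits {R : realType} (x : nat -> R) (s : bitseq) l :
  (forall j, (j < size s)%N -> x j = (nth false s j)%:R) ->
  has_run x (size s) l = infix (nseq l true) s.
Proof.
(* A window of zero-one values sums to its length exactly when all its entries are successes. *)
move=> xs; have count_full t : (count id t == size t) = (t == nseq (size t) true).
  rewrite -all_count; apply/idP/eqP => [t_id|->]; last by elim: (size t).
  by apply/all_pred1P; apply: sub_all t_id => -[].
apply/existsP/infixP => [[i /andP[il]]|[u [v suv]]].
  rewrite (sum_run_bits x s) // eqr_nat.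
  have sz : size (take l (drop i s)) = l.
    by rewrite size_takel // size_drop leq_subRL // (leq_trans _ il) ?leq_addr.
  rewrite -[X in _ == X]sz count_full sz => /eqP run.
  by exists (take i s), (drop l (drop i s)); rewrite -run !cat_take_drop.
have ul : (size u + l <= size s)%N by rewrite suv !size_cat size_nseq addnA leq_addr.
have iu : (size u < (size s).+1)%N by rewrite ltnS (leq_trans _ ul) ?leq_addr.
exists (Ordinal iu); rewrite ul (sum_run_bits x s) //= eqr_nat.
by rewrite suv drop_size_cat // take_size_cat ?size_nseq // count_nseq mul1n.
Qed.

Lemma longest_run_bits {R : realType} (x : nat -> R) (s : bitseq) :
  (forall j, (j < size s)%N -> x j = (nth false s j)%:R) ->
  longest_run x (size s) = runlen s.
Proof. by move=> xs; apply: eq_bigl => l; rewrite has_run_bits. Qed.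

Section transfer.
Context {R : realType} {d : measure_display} {T : measurableType d}.
Context (P : probability T R) (p : R) (X : nat -> {RV P >-> R}).
Hypothesis iidX : iid_bernoulli p X.

(** The cylinder where the first [n] trials spell [s], indexed by a finite set so that it matches
    the intersection in [mutually_independent]. *)
Definition bits_event (n : nat) (s : bitseq) : set T :=
  \bigcap_(j in [set` seq_fset tt (iota 0 n)]) X j @^-1` [set (nth false s j)%:R].

Lemma bits_eventP n s w :
  bits_event n s w <-> forall j, (j < n)%N -> X j w = (nth false s j)%:R.
Proof.
have in_iota j : (j \in seq_fset tt (iota 0 n)) = (j < n)%N.
  by rewrite seq_fsetE mem_iota.
split=> [sw j jn|sw j jn]; first by apply: sw; rewrite -in_iota in jn.
by apply: sw; rewrite -in_iota.
Qed.

Lemma measurable_bits_event n s : measurable (bits_event n s).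
Proof.
apply: bigcap_measurableType => j _; rewrite -[X in measurable X]setTI.
exact: measurable_funP.
Qed.

Lemma probability_bits_event n s : size s = n ->
  P (bits_event n s) = (bern_weight p s)%:E.
Proof.
case: iidX => indep X1 X0 sn; rewrite /bits_event.
rewrite (indep _ (fun j => [set (nth false s j)%:R])); last by move=> *; exact: measurable_set1.
rewrite (perm_big _ (seq_fset_perm tt _)) undup_id ?iota_uniq //=.
rewrite /bern_weight (big_nth false) sn -prodEFin /index_iota subn0.
by apply: eq_bigr => j _; case: nth; [exact: X1|exact: X0].
Qed.

Lemma trivIset_bits_event n : trivIset [set` bitseqs n] (bits_event n).
Proof.
move=> s t /=; rewrite !mem_bitseqs => /eqP sn /eqP tn [w [/bits_eventP sw /bits_eventP tw]].
apply: (@eq_from_nth _ false) => [|j]; first by rewrite sn tn.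
rewrite sn => jn; move: (sw j jn); rewrite tw // => /eqP.
by rewrite eqr_nat; do 2!case: nth.
Qed.

(** An arbitrary outer [F] lets the induction absorb each new [maxn l] into it. *)
Lemma measurable_fun_bigmax (h : nat -> T -> bool) (F : nat -> R) (r : seq nat) :
  (forall l, measurable_fun setT (h l)) ->
  measurable_fun setT (fun w => F (\max_(l <- r | h l w) l)).
Proof.
move=> mh; elim: r F => [|l r IHr] F.
  by under eq_fun do rewrite big_nil; exact: measurable_cst.
under eq_fun do rewrite big_cons (fun_if F).
by apply: measurable_fun_ifT => //; exact: (IHr (F \o maxn l)).
Qed.

Lemma measurable_longest_run n (F : nat -> R) :
  measurable_fun setT (fun w => F (longest_run (fun j => X j w) n)).
Proof.
rewrite /longest_run.
under eq_fun do rewrite -(big_mkord (fun l => has_run (X^~ _) n l) id).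
apply: measurable_fun_bigmax => l; apply: (measurable_fun_bool true).
rewrite setTI.
(* The run event is a finite union, over starting positions, of level sets of measurable sums. *)
rewrite (_ : _ @^-1` _ = \bigcup_(i in [set: 'I_n.+1])
   [set w | (i + l <= n)%N && (\sum_(i <= j < i + l) X j w == l%:R)]); last first.
  apply/seteqP; split=> w /=; first by move=> /existsP[i iw]; exists i.
  by move=> [i _ iw]; apply/existsP; exists i.
apply: fin_bigcup_measurable => // i _; case: leqP => _; last first.
  by rewrite (_ : [set _ | _] = set0) ?seteqP //; split.
rewrite (_ : [set _ | _] = (fun w => \sum_(i <= j < i + l) X j w) @^-1` [set l%:R]).
  rewrite -[X in measurable X]setTI.
  by apply: measurable_sum => // j; exact: measurable_funP.
by apply/seteqP; split=> w /= /eqP.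
Qed.

Lemma mgf_longest_run lambda n :
  'M_P (fun w => (longest_run (fun j => X j w) n)%:R) lambda =
  (run_mgf p lambda n)%:E.
Proof.
rewrite /mmt_gen_fun unlock.
pose g w : \bar R := (expR (lambda * (longest_run (fun j => X j w) n)%:R))%:E.
have mg D : measurable D -> measurable_fun D g.
  move=> mD; apply: measurable_funTS; apply/measurable_EFinP.
  exact: (measurable_longest_run n (fun k => expR (lambda * k%:R))).
have g0 w : (0 <= g w)%E by rewrite lee_fin expR_ge0.
(* Trials may leave {0, 1} on a null set, so the disjoint cylinders need not cover the space; they
   have total mass 1, and the longest run is constant on each. *)
pose D := \big[setU/set0]_(s <- bitseqs n) bits_event n s.
have mD : measurable D.
  by apply: bigsetU_measurable => s _; exact: measurable_bits_event.
have intD (f : T -> \bar R) : measurable_fun D f -> (forall w, 0 <= f w)%E ->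
    (\int[P]_(w in D) f w = \sum_(s <- bitseqs n) \int[P]_(w in bits_event n s) f w)%E.
  move=> mf f0; apply: ge0_integral_bigsetU => //.
  - exact: measurable_bits_event.
  - exact: uniq_bitseqs.
  - exact: trivIset_bits_event.
have PD : P D = 1%E.
  have := intD (cst 1%E) (measurable_cst _) (fun=> lee01).
  rewrite integral_cst // mul1e => ->.
  transitivity (\sum_(s <- bitseqs n) (bern_weight p s * 1)%:E)%E.
    rewrite big_seq [RHS]big_seq; apply: eq_bigr => s; rewrite mem_bitseqs => /eqP sn.
    rewrite integral_cst; last exact: measurable_bits_event.
    by rewrite mul1e mulr1; exact: probability_bits_event.
  by rewrite sumEFin; exact: (congr1 EFin (bern_mean_cst p n 1)).
transitivity (\int[P]_w g w)%E; first by apply: eq_integral => w _; rewrite /g mulrC.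
rewrite (@ge0_negligible_integral _ _ _ P setT (~` D)) //.
- rewrite setTD setCK intD //; last exact: mg.
  rewrite /run_mgf /bern_mean -sumEFin big_seq [RHS]big_seq; apply: eq_bigr => s.
  rewrite mem_bitseqs => /eqP sn; have ms := measurable_bits_event n s.
  transitivity (\int[P]_(w in bits_event n s) cst (expR (lambda * (runlen s)%:R))%:E w)%E.
    apply: eq_integral => w; rewrite inE => /bits_eventP sw; rewrite /g -sn.
    by rewrite (longest_run_bits _ s) // => j; rewrite sn => /sw.
  by rewrite integral_cst // muleC EFinM; congr (_ * _)%E; exact: probability_bits_event.
- exact: measurableC.
- exact: mg.
- have := probability_setC P mD; rewrite PD subee //.
Qed.

Lemma log_mgf_runE lambda n : log_mgf_run X lambda n = ln (run_mgf p lambda n).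
Proof. by rewrite /log_mgf_run mgf_longest_run. Qed.

End transfer.

(** * Growth of the logarithm and criteria for asymptotic equivalence *)

Lemma ln_le_sqrt {R : realType} (x : R) : 0 < x -> ln x <= 2 * Num.sqrt x.
Proof.
move=> x_gt0; have s_gt0 : 0 < Num.sqrt x by rewrite sqrtr_gt0.
rewrite -{1}(sqr_sqrtr (ltW x_gt0)) lnXn // mulr2n mulrDl !mul1r.
by have := ln_sublinear s_gt0; lra.
Qed.

Lemma near_ln_ge {R : realType} (M : R) : \forall n \near \oo, M <= ln (n%:R : R).
Proof.
near=> n; have n_ge : expR M <= n%:R.
  by near: n; exact: nbhs_infty_ger.
by rewrite -[M]expRK ler_ln ?posrE ?expR_gt0 // (lt_le_trans (expR_gt0 M)).
Unshelve. all: by end_near. Qed.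

Lemma near_ln_le {R : realType} (delta : R) : 0 < delta ->
  \forall n \near \oo, ln (n%:R : R) <= delta * n%:R.
Proof.
move=> delta_gt0; near=> n.
have n_gt0 : 0 < n%:R :> R by rewrite ltr0n; near: n; exact: nbhs_infty_gt.
apply: le_trans (ln_le_sqrt _ n_gt0) _.
have n_ge : (2 / delta) ^+ 2 <= n%:R by near: n; exact: nbhs_infty_ger.
have s_ge : 2 / delta <= Num.sqrt n%:R.
  by rewrite -(ler_pXn2r (n := 2)) ?nnegrE ?sqrtr_ge0 ?sqr_sqrtr ?divr_ge0 // ltW.
rewrite -{2}(sqr_sqrtr (ltW n_gt0)) expr2 mulrA ler_wpM2r ?sqrtr_ge0 //.
by rewrite mulrC -ler_pdivrMr.
Unshelve. all: by end_near. Qed.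

Lemma asymp_equiv_sqrt {R : realType} (a y : nat -> R) (c C : R) : c != 0 ->
  (forall M, \forall n \near \oo, M <= y n) ->
  (\forall n \near \oo, `|a n - c * y n| <= C * (1 + Num.sqrt (y n))) ->
  asymp_equiv a (fun n => c * y n).
Proof.
move=> c_neq0 y_pinfty a_close; apply/cvgrPdist_lt => eps eps_gt0.
have c_gt0 : 0 < `|c| by rewrite normr_gt0.
(* Once [y n >= M ^+ 2], the root [s] exceeds [M - 1], so [2 * |C| <= |c| * eps * s]; also [M >= 1]
   gives [1 + s <= 2 * s]. *)
pose M := 2 * `|C| / (`|c| * eps) + 1.
have M_ge1 : 1 <= M by rewrite lerDr divr_ge0 // mulr_ge0 // ltW.
near=> n.
have y_ge : M ^+ 2 <= y n by near: n; exact: y_pinfty.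
have y_gt0 : 0 < y n by apply: lt_le_trans y_ge; rewrite exprn_gt0 // (lt_le_trans ltr01).
have s_ge : M <= Num.sqrt (y n).
  rewrite -(ler_pXn2r (n := 2)) ?nnegrE ?sqrtr_ge0 ?sqr_sqrtr // ?(ltW y_gt0) //.
  exact: le_trans M_ge1.
have cy_neq0 : c * y n != 0 by rewrite mulf_neq0 // gt_eqF.
rewrite -[1](divff cy_neq0) -mulrBl normrM normfV ltr_pdivrMr ?normr_gt0 // distrC.
have : `|a n - c * y n| <= C * (1 + Num.sqrt (y n)) by near: n.
move=> /le_lt_trans; apply; rewrite normrM (gtr0_norm y_gt0) -[in ltRHS](sqr_sqrtr (ltW y_gt0)).
set s := Num.sqrt (y n) in s_ge *.
have Ms : M - 1 < s by lra.
have CM : 2 * `|C| = (M - 1) * (`|c| * eps).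
  by rewrite /M addrK divfK // mulf_neq0 ?gt_eqF.
have s_gt0 : 0 < s by lra.
apply: (@le_lt_trans _ _ (2 * `|C| * s)); last first.
  rewrite CM (_ : eps * _ = s * (`|c| * eps) * s); last by ring.
  by rewrite !ltr_pM2r // mulr_gt0.
rewrite (_ : 2 * _ * _ = `|C| * (2 * s)); last by ring.
apply: (@le_trans _ _ (`|C| * (1 + s))); first by rewrite ler_wpM2r ?ler_norm //; lra.
by rewrite ler_wpM2l //; lra.
Unshelve. all: by end_near. Qed.

Lemma asymp_equiv_of_bounds {R : realType} (a y : nat -> R) (c A B D : R) :
  c != 0 -> (forall M, \forall n \near \oo, M <= y n) ->
  (\forall n \near \oo, A + c * y n <= a n /\
     a n <= B + D * Num.sqrt (y n) + c * y n) ->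
  asymp_equiv a (fun n => c * y n).
Proof.
move=> c_neq0 y_pinfty a_bounds.
apply: (asymp_equiv_sqrt _ _ _ (`|A| + `|B| + `|D|)) => //.
near=> n; have [lo hi] : A + c * y n <= a n /\
    a n <= B + D * Num.sqrt (y n) + c * y n by near: n.
set s := Num.sqrt (y n) in hi *.
have s_ge0 : 0 <= s by exact: sqrtr_ge0.
have := ler_norm (- A); rewrite normrN => A_le.
have Ds : D * s <= `|D| * s by rewrite ler_wpM2r ?ler_norm.
have As : 0 <= `|A| * s by rewrite mulr_ge0.
have Bs : 0 <= `|B| * s by rewrite mulr_ge0.
have Ds0 : 0 <= `|D| * s by rewrite mulr_ge0.
have := ler_norm B; have := normr_ge0 A; have := normr_ge0 B; have := normr_ge0 D.
by rewrite ler_norml mulrDr mulr1 !mulrDl => *; apply/andP; split; lra.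
Unshelve. all: by end_near. Qed.

(** Positivity of [m], and then of [B], is inherited from the lower bound, so all logarithms are
    genuine. *)
Lemma ln_bounds {R : realType} (m u v A B : R) : 0 < A ->
  A * expR u <= m -> m <= B * expR v -> ln A + u <= ln m /\ ln m <= ln B + v.
Proof.
move=> A_gt0 lo hi.
have Au_gt0 : 0 < A * expR u by rewrite mulr_gt0 ?expR_gt0.
have m_gt0 := lt_le_trans Au_gt0 lo.
have B_gt0 : 0 < B by have := lt_le_trans m_gt0 hi; rewrite pmulr_lgt0 // expR_gt0.
have Bv_gt0 : 0 < B * expR v by rewrite mulr_gt0 ?expR_gt0.
split; first by rewrite -[u]expRK -lnM ?posrE ?expR_gt0 // ler_ln ?posrE.
by rewrite -[v]expRK -lnM ?posrE ?expR_gt0 // ler_ln ?posrE.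
Qed.

Lemma geometric_sum_le {R : realFieldType} (r : R) k m : 0 <= r -> r < 1 ->
  \sum_(k <= l < m) r ^+ l <= r ^+ k / (1 - r).
Proof.
move=> r_ge0 r_lt1; have r1 : 0 < 1 - r by rewrite subr_gt0.
have [mk|km] := leqP m k; first by rewrite big_geq // divr_ge0 ?exprn_ge0 // ltW.
rewrite ler_pdivlMr //; apply: (@le_trans _ _ (r ^+ k - r ^+ m)); last first.
  by rewrite gerBl exprn_ge0.
rewrite le_eqVlt; apply/orP; left; apply/eqP.
rewrite -(subnKC (ltnW km)); elim: (m - k)%N => [|j IHj].
  by rewrite addn0 big_geq // mul0r subrr.
rewrite addnS big_nat_recr ?leq_addr //= mulrDl IHj exprS; ring.
Qed.

(** * Estimates at run lengths near log n to base 1/p *)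

Section run_mgf_asymptotics.
Context {R : realType} (p : R).
Hypotheses (p_gt0 : 0 < p) (p_lt1 : p < 1).

Let c := ln (1 / p).

Let c_gt0 : 0 < c.
Proof. by rewrite ln_gt0 // div1r invf_gt1. Qed.

Let q_gt0 : 0 < 1 - p. Proof. by rewrite subr_gt0. Qed.

Let expr_pE l : p ^+ l = expR (- (c * l%:R)).
Proof. by rewrite expRN expRM_natr /c div1r lnK ?posrE ?invr_gt0 // exprVn invrK. Qed.

Let natrE (n : nat) : (0 < n)%N -> n%:R = expR (ln n%:R) :> R.
Proof. by move=> n_gt0; rewrite lnK // posrE ltr0n. Qed.

Let p_ge0 := ltW p_gt0.
Let p_le1 := ltW p_lt1.

Let log_floor n (l := Num.trunc (ln n%:R / c : R)) : (0 < n)%N ->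
  c * l%:R <= ln n%:R /\ ln n%:R <= c * l.+1%:R.
Proof.
move=> n_gt0; have z_ge0 : 0 <= ln n%:R / c.
  by rewrite divr_ge0 ?(ltW c_gt0) // ln_ge0 // ler1n.
have /andP[lo hi] := truncn_itv z_ge0; rewrite mulrC -ler_pdivlMr // lo; split=> //.
by rewrite mulrC -ler_pdivrMr // ltW.
Qed.

(** Beyond [k] the summands are at most [n * r ^ l] with [r = expR (lambda - c) < 1]. The geometric
    tail is led by [n * r ^ k.+1], which is at most [expR (lambda * k.+1)] because
    [n <= expR (c * k.+1)]. *)
Let subcritical_mass lambda n k : 0 < lambda -> lambda < c -> (0 < n)%N ->
  ln n%:R <= c * k.+1%:R ->
  run_mgf p lambda n <=
  (1 + expR lambda / (1 - expR (lambda - c))) * expR (lambda * k%:R).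
Proof.
move=> lambda_gt0 lambda_lt n_gt0 nk.
apply: le_trans (run_mgf_ub_ge0 p p_ge0 p_le1 lambda n k (ltW lambda_gt0)) _.
rewrite mulrDl mul1r lerD2l; set r := expR (lambda - c).
have r_gt0 : 0 < r by rewrite expR_gt0.
have r_lt1 : r < 1 by rewrite expR_lt1 subr_lt0.
apply: (@le_trans _ _ (\sum_(k.+1 <= l < n.+1) n%:R * r ^+ l)).
  apply: ler_sum => l _; rewrite -expRM_natr mulrBl expRD -expr_pE mulrCA ler_wpM2l ?expR_ge0 //.
  exact: run_prob_ub.
rewrite -big_distrr /=.
apply: (@le_trans _ _ (n%:R * (r ^+ k.+1 / (1 - r)))).
  by rewrite ler_wpM2l // geometric_sum_le // ltW.
rewrite [leRHS]mulrAC mulrA ler_wpM2r ?invr_ge0 ?subr_ge0 ?(ltW r_lt1) //.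
by rewrite -expRM_natr natrE // -!expRD ler_expR -natr1; move: nk; rewrite -natr1; nra.
Qed.

(** Here [n * p ^+ l >= 1] and [n - l >= n / 2], so [run_prob_lb] reads
    [(1 - p) / 2 * (1 - a) <= a]; solving for [a] leaves at least [(1 - p) / 4]. *)
Let run_prob_log_lb n l : (0 < n)%N -> (l <= n)%N -> 2 * l%:R <= n%:R :> R ->
  c * l%:R <= ln n%:R -> (1 - p) / 4 <= run_prob p n l.
Proof.
move=> n_gt0 l_le l2n cl; have := run_prob_lb p p_ge0 p_le1 n l l_le.
have npl : 1 <= n%:R * p ^+ l.
  by rewrite expr_pE natrE // -expRD -[leLHS]expR0 ler_expR subr_ge0.
have := run_prob_le1 p p_ge0 p_le1 n l; have := run_prob_ge0 p p_ge0 p_le1 n l.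
have pl_gt0 : 0 < p ^+ l by rewrite exprn_gt0.
rewrite natrB //; set a := run_prob p n l => a_ge0 a_le1 lb.
have x_ge : (1 - p) / 2 <= (n%:R - l%:R) * ((1 - p) * p ^+ l).
  have npl2 : 1 <= 2 * (n%:R - l%:R) * p ^+ l.
    by apply: le_trans npl _; rewrite ler_wpM2r ?(ltW pl_gt0) //; lra.
  have q2_ge0 : 0 <= (1 - p) / 2 by rewrite divr_ge0 // ltW.
  by have := ler_wpM2l q2_ge0 npl2; lra.
have : (1 - p) / 2 * (1 - a) <= a by apply: le_trans lb; rewrite ler_wpM2r ?subr_ge0.
by move: p_lt1 p_gt0 a_le1; nra.
Qed.

(** By [1 - x <= expR (- x)] and [n - l >= n / 2], the power in [no_run_prob_ub] is at most
    [expR (- (1 - p) * n * p ^+ l / 2)]. *)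
Let no_run_prob_le_exp (D : R) n l : (l <= n)%N -> 2 * l%:R <= n%:R :> R ->
  2 * D / (1 - p) * ln n%:R <= n%:R * p ^+ l ->
  1 - run_prob p n l <= expR (- (D * ln n%:R)).
Proof.
move=> l_le l2n npl; apply: le_trans (no_run_prob_ub p p_ge0 p_le1 n l l_le) _.
have : p ^+ l <= 1 by rewrite exprn_ile1.
have : 0 < p ^+ l by rewrite exprn_gt0.
move: (p ^+ l) npl => u npl u_gt0 u_le1.
apply: (@le_trans _ _ (expR (- ((1 - p) * u)) ^+ (n - l))).
  rewrite lerXn2r ?nnegrE ?expR_ge0 ?subr_ge0 ?mulr_ile1 ?(ltW q_gt0) ?(ltW u_gt0) //.
    by rewrite gerBl.
  exact: expR_ge1Dx.
rewrite -expRM_natr ler_expR natrB // mulNr lerN2.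
have -> : D * ln n%:R = (1 - p) / 2 * (2 * D / (1 - p) * ln n%:R).
  by field; rewrite gt_eqF.
apply: (@le_trans _ _ ((1 - p) / 2 * (n%:R * u))).
  by rewrite ler_wpM2l // divr_ge0 // ltW.
rewrite (_ : _ * (_ * u) = (1 - p) * u * (n%:R / 2)); last by ring.
by rewrite ler_wpM2l ?mulr_ge0 ?(ltW q_gt0) ?(ltW u_gt0) //; lra.
Qed.

Let near_half (l : nat -> nat) :
  (\forall n \near \oo, c * (l n)%:R <= ln n%:R) ->
  \forall n \near \oo, [/\ (0 < n)%N, (l n <= n)%N & 2 * (l n)%:R <= n%:R :> R].
Proof.
move=> cl; near=> n; have n_gt0 : (0 < n)%N by near: n; exact: nbhs_infty_gt.
have l2n : 2 * (l n)%:R <= n%:R :> R.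
  rewrite -(ler_pM2l c_gt0); have : c * (l n)%:R <= ln n%:R by near: n.
  have : ln n%:R <= c / 2 * n%:R by near: n; apply: near_ln_le; rewrite divr_gt0.
  lra.
by split=> //; rewrite -(ler_nat R); have := ler0n R (l n); lra.
Unshelve. all: by end_near. Qed.

(** * Subcritical regime *)

Lemma ln_run_mgf_subcritical_pos lambda : 0 < lambda -> lambda < c ->
  asymp_equiv (fun n => ln (run_mgf p lambda n)) (fun n => lambda / c * ln n%:R).
Proof.
move=> lambda_gt0 lambda_lt.
pose l n := Num.trunc (ln n%:R / c : R).
pose B := 1 + expR lambda / (1 - expR (lambda - c)).
(* A run of length [l n] has probability at least [(1 - p) / 4]; the factor [expR (- lambda)] pays
   for rounding the length down. *)
apply: (asymp_equiv_of_bounds _ _ _ (ln ((1 - p) / 4 * expR (- lambda))) (ln B) 0).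
- by rewrite mulf_neq0 ?invr_neq0 ?gt_eqF.
- exact: near_ln_ge.
near=> n; rewrite mul0r addr0.
have [n_gt0 l_le l2n] : [/\ (0 < n)%N, (l n <= n)%N & 2 * (l n)%:R <= n%:R :> R].
  near: n; apply: near_half; near=> n; have n_gt0 : (0 < n)%N by near: n; exact: nbhs_infty_gt.
  by have [] := log_floor n n_gt0.
have [lo hi] := log_floor n n_gt0.
have lc_gt0 : 0 < lambda / c by rewrite divr_gt0.
apply: ln_bounds.
- by rewrite mulr_gt0 ?expR_gt0 // divr_gt0 ?subr_gt0.
- apply: le_trans (run_mgf_lb_ge0 p p_ge0 p_le1 lambda n (l n) (ltW lambda_gt0)).
  rewrite -[leLHS]mulrA mulrC ler_pM ?mulr_ge0 ?expR_ge0 ?divr_ge0 ?(ltW q_gt0) //; last first.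
    exact: run_prob_log_lb.
  rewrite -expRD ler_expR; have := ler_wpM2l (ltW lc_gt0) hi.
  by rewrite mulrA divfK ?gt_eqF // -natr1; lra.
- apply: le_trans (subcritical_mass lambda n (l n) lambda_gt0 lambda_lt n_gt0 hi) _.
  rewrite ler_wpM2l //.
    rewrite addr_ge0 ?divr_ge0 ?expR_ge0 // subr_ge0 ltW // expR_lt1 subr_lt0 //.
  by rewrite ler_expR; have := ler_wpM2l (ltW lc_gt0) lo; rewrite mulrA divfK ?gt_eqF.
Unshelve. all: by end_near. Qed.

Lemma ln_run_mgf_subcritical_neg lambda : lambda < 0 ->
  asymp_equiv (fun n => ln (run_mgf p lambda n)) (fun n => lambda / c * ln n%:R).
Proof.
(* The target is [n ^ - D], and [E] is the constant in the hypothesis of [no_run_prob_le_exp]. *)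
move=> lambda_lt0; pose D := - lambda / c; pose E := 2 * D / (1 - p).
have D_gt0 : 0 < D by rewrite divr_gt0 // oppr_gt0.
have E_gt0 : 0 < E by rewrite divr_gt0 // mulr_gt0.
have lambdaE : lambda = - (D * c) by rewrite /D divfK ?opprK ?gt_eqF.
have lambda_le0 := ltW lambda_lt0.
(* This choice makes the expected number of runs of length [l n] a multiple of
   [ln n], so that such a run is missing with probability at most [n^-D]. *)
pose l n := Num.trunc ((ln n%:R - ln (E * ln n%:R)) / c : R).
(* Shortening the length by [ln (E * ln n) / c] costs [D * ln (E * ln n)], at most [D * ln E] plus
   [2 * D] times the root of [ln n]; [- lambda] is the rounding loss. *)
apply: (asymp_equiv_of_bounds _ _ _ (ln ((1 - p) * expR lambda))
  (ln 2 + D * ln E - lambda) (2 * D)).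
- by rewrite mulf_neq0 ?invr_neq0 ?(gt_eqF c_gt0) ?(lt_eqF lambda_lt0).
- exact: near_ln_ge.
have near_l : \forall n \near \oo, [/\ 1 <= E * ln n%:R, 0 < ln n%:R :> R &
    0 <= ln n%:R - ln (E * ln n%:R)].
  near=> n.
  (* From 16 on, twice the root of [y] is at most [y / 2]; the other half of [y] covers [ln E], so
     the truncated quantity is nonnegative. *)
  have y_ge16 : 16 <= ln n%:R :> R by near: n; exact: near_ln_ge.
  have y_geE : E^-1 <= ln n%:R by near: n; exact: near_ln_ge.
  have y_gelnE : 2 * ln E <= ln n%:R by near: n; exact: near_ln_ge.
  set y := ln n%:R in y_ge16 y_geE y_gelnE *.
  have y_gt0 : 0 < y by lra.
  split=> //; first by rewrite mulrC -ler_pdivrMr // div1r.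
  rewrite lnM ?posrE //; have := ln_le_sqrt _ y_gt0.
  have s_ge4 : 4 <= Num.sqrt y.
    rewrite -(ler_pXn2r (n := 2)) ?nnegrE ?sqrtr_ge0 ?sqr_sqrtr ?(ltW y_gt0) //.
    by apply: le_trans y_ge16; lra.
  by have := sqr_sqrtr (ltW y_gt0); nra.
have trunc_le m : [/\ 1 <= E * ln m%:R, 0 < ln m%:R :> R &
    0 <= ln m%:R - ln (E * ln m%:R)] -> c * (l m)%:R <= ln m%:R - ln (E * ln m%:R).
  by move=> [_ _ z]; rewrite mulrC -ler_pdivlMr // truncn_le divr_ge0 // ltW.
near=> n.
have [Ey_ge1 y_gt0 z_ge0] : [/\ 1 <= E * ln n%:R, 0 < ln n%:R :> R &
    0 <= ln n%:R - ln (E * ln n%:R)] by near: n.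
have [n_gt0 l_le l2n] : [/\ (0 < n)%N, (l n <= n)%N & 2 * (l n)%:R <= n%:R :> R].
  near: n; apply: near_half; near=> n.
  have facts : [/\ 1 <= E * ln n%:R, 0 < ln n%:R :> R &
    0 <= ln n%:R - ln (E * ln n%:R)] by near: n.
  by apply: le_trans (trunc_le n facts) _; have [Ey _ _] := facts; rewrite gerBl ln_ge0.
have lo := trunc_le n (And3 Ey_ge1 y_gt0 z_ge0).
have hi : ln n%:R - ln (E * ln n%:R) <= c * (l n).+1%:R.
  by rewrite [leRHS]mulrC -ler_pdivrMr // ltW // truncnS_gt.
have lnEy : ln (E * ln n%:R) <= ln E + 2 * Num.sqrt (ln n%:R) :> R.
  by rewrite lnM ?posrE // lerD2l ln_le_sqrt.
have lnEy_ge0 : 0 <= ln (E * ln n%:R) by rewrite ln_ge0.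
have Dk : lambda / c * ln n%:R = - (D * ln n%:R).
  by rewrite {1}lambdaE mulNr mulfK ?gt_eqF // mulNr.
have Ey_gt0 : 0 < E * ln n%:R by exact: lt_le_trans Ey_ge1.
have no_run : 1 - run_prob p n (l n) <= expR (lambda / c * ln n%:R).
  rewrite Dk; apply: no_run_prob_le_exp => //.
  rewrite expr_pE [n%:R in leRHS]natrE // -expRD -[leLHS]lnK ?posrE //.
  by rewrite ler_expR lerBrDr addrC -lerBrDr.
have [floor_lo floor_hi] := log_floor n n_gt0.
set k := Num.trunc (ln n%:R / c) in floor_lo floor_hi.
suff [-> up] : ln ((1 - p) * expR lambda) + lambda / c * ln n%:R <= ln (run_mgf p lambda n) /\
    ln (run_mgf p lambda n) <= ln 2 + (- lambda + lambda / c * ln n%:R + D * ln (E * ln n%:R)).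
  split=> //; apply: le_trans up _.
  by have := ler_wpM2l (ltW D_gt0) lnEy; lra.
apply: ln_bounds.
- by rewrite mulr_gt0 ?expR_gt0.
(* With cap [k.+1], a longer run has probability at most [n * p ^+ k.+2 <= p], which leaves mass at
   least [1 - p]. *)
- apply: le_trans (run_mgf_lb_le0 p p_ge0 p_le1 lambda n k.+1 lambda_le0).
  rewrite mulrAC -mulrA mulrC ler_pM ?mulr_ge0 ?expR_ge0 ?(ltW q_gt0) //.
    rewrite -expRD ler_expR Dk -natr1.
    have := ler_wpM2l (ltW D_gt0) floor_lo; rewrite mulrA -[D * c]opprK -lambdaE; lra.
  rewrite lerD2l lerN2; apply: le_trans (run_prob_ub p p_ge0 p_le1 n k.+2 n_gt0) _.
  rewrite exprSr mulrA ler_piMl // expr_pE natrE // -expRD -[leRHS]expR0 ler_expR.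
  by rewrite subr_le0.
- apply: le_trans (run_mgf_ub_le0 p p_ge0 p_le1 lambda n (l n) lambda_le0) _.
  rewrite [2]mulr2n mulrDl mul1r; apply: lerD.
    rewrite ler_expR Dk; have := ler_wpM2l (ltW D_gt0) hi.
    by rewrite mulrA -[D * c]opprK -lambdaE -natr1; lra.
  apply: le_trans no_run _; rewrite ler_expR.
  by have := mulr_ge0 (ltW D_gt0) lnEy_ge0; lra.
Unshelve. all: by end_near. Qed.

(** * Critical regime *)

Let critical_mass_lb n : (4 <= n)%N -> ln 2 <= ln n%:R :> R ->
  ln n%:R <= c / 16 * n%:R -> (1 - p) ^+ 2 / 32 * n%:R ^+ 2 <= run_mgf p c n.
Proof.
move=> n_ge4 y_ge y_le; have n_gt0 : (0 < n)%N by exact: leq_trans n_ge4.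
(* The block [k <= l < 2 * k] has at least [n / 8] lengths, all at most [n / 2]; each will
   contribute at least [(1 - p) ^+ 2 / 4 * n]. *)
have [k [k_gt0 k4n k8n]] : exists k, [/\ (0 < k)%N, (4 * k <= n)%N & (n <= 8 * k)%N].
  by exists (n %/ 4)%N; split; lia.
have k4nR : 4 * k%:R <= n%:R :> R by rewrite -natrM ler_nat.
have k8nR : n%:R <= 8 * k%:R :> R by rewrite -natrM ler_nat.
apply: le_trans (run_mgf_lb_critical p p_ge0 p_le1 n p_gt0).
apply: (@le_trans _ _ (\sum_(k <= l < 2 * k) (1 - p) ^+ 2 / 4 * n%:R)).
  rewrite big_const_nat iter_addr_0 mul2n -addnn addnK -[leRHS]mulr_natr.
  have -> : (1 - p) ^+ 2 / 32 * n%:R ^+ 2 = (1 - p) ^+ 2 / 4 * n%:R * (n%:R / 8) by field.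
  rewrite ler_wpM2l ?mulr_ge0 ?exprn_ge0 ?(ltW q_gt0) // ?invr_ge0 //.
  by rewrite ler_pdivrMr // mulrC.
have q_ge0 := ltW q_gt0.
have term_ge0 l : 0 <= (1 - p) * p^-1 ^+ l * run_prob p n l.
  by rewrite !mulr_ge0 ?exprn_ge0 ?invr_ge0 // run_prob_ge0.
have kk : (k <= 2 * k)%N by rewrite leq_pmull.
have k2n : (2 * k <= n)%N by apply: leq_trans k4n; rewrite leq_mul2r orbT.
rewrite [leRHS](big_cat_nat (n := k)) ?(leq_trans kk (leqW k2n)) //=.
rewrite [X in _ <= _ + X](big_cat_nat (n := (2 * k)%N)) ?leqW //=.
rewrite ler_wpDl ?sumr_ge0 // ler_wpDr ?sumr_ge0 //.
rewrite big_nat_cond [leRHS]big_nat_cond; apply: ler_sum => l.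
rewrite andbT => /andP[kl lk].
have l_le : (l <= n)%N := leq_trans (ltnW lk) k2n.
have lR : k%:R <= l%:R :> R by rewrite ler_nat.
have l2R : l%:R <= 2 * k%:R :> R by rewrite -natrM ler_nat ltnW.
(* Since [c * l >= c * n / 8 >= 2 * ln n >= ln n + ln 2], the bound [n * p ^+ l] is at most one
   half. *)
have a_le : run_prob p n l <= 1 / 2.
  apply: le_trans (run_prob_ub p p_ge0 p_le1 n l n_gt0) _.
  rewrite expr_pE natrE // -expRD -[1 / 2]lnK ?posrE ?divr_gt0 // ler_expR.
  rewrite div1r lnV ?posrE //.
  have : c * n%:R <= c * (8 * l%:R) by rewrite ler_wpM2l ?(ltW c_gt0) //; lra.
  by move: y_ge y_le; lra.
have lb := run_prob_lb p p_ge0 p_le1 n l l_le.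
have pl_gt0 : 0 < p ^+ l by rewrite exprn_gt0.
have lb2 : n%:R / 2 * ((1 - p) * p ^+ l) * (1 / 2) <= run_prob p n l.
  apply: le_trans lb; apply: ler_pM; rewrite ?mulr_ge0 ?(ltW pl_gt0) //; last by lra.
  by rewrite ler_wpM2r ?mulr_ge0 ?(ltW pl_gt0) // natrB //; lra.
have c_ge0 : 0 <= (1 - p) * p^-1 ^+ l by rewrite mulr_ge0 ?exprn_ge0 ?invr_ge0.
apply: le_trans (ler_wpM2l c_ge0 lb2); rewrite exprVn.
by rewrite le_eqVlt; apply/orP; left; apply/eqP; field; rewrite gt_eqF.
Qed.

(** At the critical parameter [expR (c * l)] cancels [p ^+ l], so each of the [n] summands is at
    most [n]. *)
Let critical_mass_ub n : (0 < n)%N -> run_mgf p c n <= 2 * n%:R ^+ 2.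
Proof.
move=> n_gt0; apply: le_trans (run_mgf_ub_ge0 p p_ge0 p_le1 c n 0 (ltW c_gt0)) _.
rewrite mulr0 expR0; apply: (@le_trans _ _ (1 + \sum_(1 <= l < n.+1) n%:R)).
  rewrite lerD2l; apply: ler_sum => l _.
  have := ler_wpM2l (expR_ge0 (c * l%:R)) (run_prob_ub p p_ge0 p_le1 n l n_gt0).
  by move=> /le_trans; apply; rewrite mulrCA expr_pE -expRD subrr expR0 mulr1.
rewrite big_const_nat iter_addr_0 subn1 /= -[_ *+ n]mulr_natr -expr2 [2 in leRHS]mulr2n.
by rewrite mulrDl mul1r lerD2r exprn_ege1 // ler1n.
Qed.

Lemma ln_run_mgf_critical :
  asymp_equiv (fun n => ln (run_mgf p c n)) (fun n => 2 * ln n%:R).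
Proof.
apply: (asymp_equiv_of_bounds _ _ _ (ln ((1 - p) ^+ 2 / 32)) (ln 2) 0) => //.
  exact: near_ln_ge.
have c16_gt0 : 0 < c / 16 by rewrite divr_gt0.
near=> n; rewrite mul0r addr0.
have y_le : ln n%:R <= c / 16 * n%:R by near: n; exact: near_ln_le.
have n_ge4 : (4 <= n)%N by near: n; exact: nbhs_infty_ge.
have y_ge : ln 2 <= ln n%:R :> R by near: n; exact: near_ln_ge.
have n_gt0 : (0 < n)%N by exact: leq_trans n_ge4.
have expR2 : expR (2 * ln n%:R) = n%:R ^+ 2 :> R by rewrite expRM_natl -natrE.
apply: ln_bounds; rewrite ?expR2.
- by rewrite divr_gt0 // exprn_gt0.
- exact: critical_mass_lb.
- exact: critical_mass_ub.
Unshelve. all: by end_near. Qed.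

(** * Supercritical regime *)

Lemma ln_run_mgf_supercritical lambda : c < lambda ->
  asymp_equiv (fun n => ln (run_mgf p lambda n)) (fun n => (lambda - c) * n%:R).
Proof.
move=> lambda_gt; have d_gt0 : 0 < lambda - c by rewrite subr_gt0.
have lambda_ge0 : 0 <= lambda by rewrite ltW // (lt_trans c_gt0).
(* The scale is now [n] itself. The upper bound is [2 * n ^+ 2 * expR ((lambda - c) * n)], and
   [2 * ln n] is at most 4 times the root of [n]. *)
apply: (asymp_equiv_of_bounds _ _ _ (ln 1) (ln 2) 4); first by rewrite gt_eqF.
  by move=> M; near=> n; near: n; exact: nbhs_infty_ger.
near=> n; have n_gt0 : (0 < n)%N by near: n; exact: nbhs_infty_gt.
have y_le := ln_le_sqrt (n%:R : R); rewrite ltr0n n_gt0 in y_le.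
suff [lo hi] : ln 1 + (lambda - c) * n%:R <= ln (run_mgf p lambda n) /\
    ln (run_mgf p lambda n) <= ln 2 + (2 * ln n%:R + (lambda - c) * n%:R).
  by split=> //; apply: le_trans hi _; have := y_le isT; lra.
apply: ln_bounds => //.
(* The all-success sequence alone contributes [expR (lambda * n) * p ^+ n]. *)
- apply: le_trans (run_mgf_lb_ge0 p p_ge0 p_le1 lambda n n lambda_ge0).
  rewrite mul1r mulrBl expRD -expr_pE ler_wpM2l ?expR_ge0 //; exact: run_prob_all.
- apply: le_trans (run_mgf_ub_ge0 p p_ge0 p_le1 lambda n 0 lambda_ge0) _.
  rewrite mulr0 expR0 expRD expRM_natl -natrE //.
  set e := expR ((lambda - c) * n%:R).
  have e_ge1 : 1 <= e by rewrite -expR0 ler_expR mulr_ge0 // ltW.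
  apply: (@le_trans _ _ (1 + \sum_(1 <= l < n.+1) n%:R * e)).
    rewrite lerD2l big_nat_cond [leRHS]big_nat_cond; apply: ler_sum => l.
    rewrite andbT ltnS => /andP[_ l_le].
    have := ler_wpM2l (expR_ge0 (lambda * l%:R)) (run_prob_ub p p_ge0 p_le1 n l n_gt0).
    move=> /le_trans; apply; rewrite mulrCA expr_pE -expRD -mulrBl ler_wpM2l //.
    by rewrite ler_expR ler_wpM2l ?(ltW d_gt0) // ler_nat.
  rewrite big_const_nat iter_addr_0 subn1 /= -[_ *+ n]mulr_natr mulrAC -expr2 [2 in leRHS]mulr2n.
  by rewrite mulrDl mul1r lerD2r mulr_ege1 // exprn_ege1 // ler1n.
Unshelve. all: by end_near. Qed.

End run_mgf_asymptotics.

Theorem theorem1 (R : realType) (d : measure_display) (T : measurableType d)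
    (P : probability T R) (p : R) (X : nat -> {RV P >-> R})
    (p_gt0 : 0 < p) (p_lt1 : p < 1) (iidX : iid_bernoulli p X) :
  [/\ (forall lambda : R, lambda < ln (1 / p) ->
        (lambda != 0 ->
          asymp_equiv (log_mgf_run X lambda)
                      (fun n => lambda * log_base (1 / p) n%:R)) /\
        (lambda = 0 -> forall n : nat, (0 < n)%N ->
          log_mgf_run X lambda n = 0 /\
          lambda * log_base (1 / p) n%:R = 0)),
      (forall lambda : R, lambda = ln (1 / p) ->
        asymp_equiv (log_mgf_run X lambda)
                    (fun n => 2 * lambda * log_base (1 / p) n%:R)) &
      (forall lambda : R, ln (1 / p) < lambda ->
        asymp_equiv (log_mgf_run X lambda)
                    (fun n => (lambda - ln (1 / p)) * n%:R))].
Proof.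
have [p_ge0 p_le1] := (ltW p_gt0, ltW p_lt1).
have logE lambda : log_mgf_run X lambda = (fun n => ln (run_mgf p lambda n)).
  by apply: funext => n; exact: log_mgf_runE.
(* Changes base to put the claims on the scale [ln n] of the regime lemmas; at the critical
   parameter the slope becomes 2. *)
have slope (a : R) : (fun n => a * log_base (1 / p) n%:R) =
    (fun n => a / ln (1 / p) * ln n%:R).
  by apply: funext => n; rewrite /log_base mulrA mulrAC.
have c_gt0 : 0 < ln (1 / p) by rewrite ln_gt0 // div1r invf_gt1.
split=> lambda.
- move=> lambda_lt; split=> [lambda_neq0|-> n n_gt0].
    rewrite logE slope; case: (ltgtP lambda 0) lambda_neq0 => // [lt0|gt0] _.
      exact: ln_run_mgf_subcritical_neg.
    exact: ln_run_mgf_subcritical_pos.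
  rewrite logE mul0r /run_mgf; split=> //.
  under eq_bern_mean do rewrite mul0r expR0.
  by rewrite bern_mean_cst ln1.
- move=> ->; rewrite logE slope mulfK ?gt_eqF //.
  exact: ln_run_mgf_critical.
- by move=> lambda_gt; rewrite logE; exact: ln_run_mgf_supercritical.
Qed.
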